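(* Assume $\bm\lambda\neq0$ and $\bm\mu\neq0$. For every $d\in\mathbb C$, the quotient $L(d,\bm\lambda,\bm\mu)=M_1(\bm\lambda,\bm\mu)/N_d$ is an irreducible $\widehat{\mathfrak{gl}}$-module (no nonzero proper subspace is invariant under all $E_{i,j}$); consequently it is also an irreducible module for $\mathcal W_{1+\infty,c=-1}\cong M^0$.
   Context: Let $\widehat{\mathcal A}$ be the Weyl algebra: the unital associative complex algebra generated by $a(r),a^*(r)$ ($r\in\mathbb Z$) with relations $[a(r),a(s)]=[a^*(r),a^*(s)]=0$ and $[a(r),a^*(s)]=\delta_{r+s,0}$. Fix integers $n\ge 0$, $m\ge 1$, $\bm\lambda=(\lambda_0,\dots,\lambda_n)\in\mathbb C^{n+1}$, $\bm\mu=(\mu_1,\dots,\mu_m)\in\mathbb C^m$, and set $\lambda_i=0$ for $i>n$, $\mu_j=0$ for $j>m$. The Whittaker module $M_1(\bm\lambda,\bm\mu)=\widehat{\mathcal A}/\mathcal I$, where $\mathcal I$ is the left ideal generated by $a(i)-\lambda_i$ ($i\ge 0$) and $a^*(j)-\mu_j$ ($j\ge 1$); $w=w_{\bm\lambda,\bm\mu}$ denotes the image of $1$. Normal ordering: $:a(i)a^*(j):$ equals $a^*(j)a(i)$ if $i\ge 0$ and $j\le 0$, and equals $a(i)a^*(j)$ otherwise. For $i,j\in\mathbb Z$, $E_{i,j}:=\,:a(-i)a^*(j):$ (operators giving a $\widehat{\mathfrak{gl}}$-module structure of central charge $-1$), and $I:=\sum_{j\in\mathbb Z}E_{j,j}$,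 a well-defined operator on $M_1(\bm\lambda,\bm\mu)$ commuting with all $E_{i,j}$. For $d\in\mathbb C$, $N_d$ is the smallest subspace of $M_1(\bm\lambda,\bm\mu)$ invariant under all $E_{i,j}$ and containing $(I-d)I^kw$ for all $k\ge0$, and $L(d,\bm\lambda,\bm\mu):=M_1(\bm\lambda,\bm\mu)/N_d$. The $\mathcal W_{1+\infty,c=-1}$-module structure is given by the operators $T_{r,f}=\sum_{j}f(-j):a(r-j)a^*(j):$ ($r\in\mathbb Z$, $f\in\mathbb C[x]$), which are the modes of the generating fields of $M^0=\ker J^0(0)\subset M$ (Weyl vertex algebra), $M^0\cong\mathcal W_{1+\infty,c=-1}$. *)

(* Defs.v *)
From HB Require Import structures.
From mathcomp Require Import all_boot all_order all_algebra complex.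
From mathcomp Require Import reals.
From Stdlib Require Import ClassicalEpsilon.
Set Implicit Arguments. Unset Strict Implicit. Unset Printing Implicit Defensive.
Import Order.TTheory GRing.Theory Num.Theory.
Local Open Scope ring_scope.

Definition is_subspace (C : fieldType) (V : lmodType C) (U : V -> Prop) :=
  [/\ U 0, (forall u v, U u -> U v -> U (u + v))
    & (forall (c : C) u, U u -> U (c *: u))].

Definition invariant (C : fieldType) (V : lmodType C) (X : Type)
  (ops : X -> V -> V) (U : V -> Prop) :=
  forall x v, U v -> U (ops x v).

Definition irreducible_quotient (C : fieldType) (V : lmodType C) (X : Type)
  (ops : X -> V -> V) (N : V -> Prop) :=
  [/\ invariant ops N,
      (exists v, ~ N v)
    & forall U : V -> Prop, is_subspace U -> (forall v, N v -> U v) ->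
        invariant ops U -> (forall v, U v -> N v) \/ (forall v, U v)].

Definition is_weyl_module (C : fieldType) (V : lmodType C)
  (a as_ : int -> V -> V) :=
  [/\ (forall r (c : C) u v, a r (c *: u + v) = c *: a r u + a r v),
      (forall r (c : C) u v, as_ r (c *: u + v) = c *: as_ r u + as_ r v),
      (forall r s v, a r (a s v) = a s (a r v)),
      (forall r s v, as_ r (as_ s v) = as_ s (as_ r v))
    & (forall r s v, a r (as_ s v) - as_ s (a r v) = (r + s == 0)%:R *: v)].

(* lambda_i (i >= 0), zero for i > n;  mu_j (j >= 1), zero for j > m. *)
Definition lamE (C : fieldType) (n : nat) (lam : 'I_n.+1 -> C) (i : nat) : C :=
  if (i < n.+1)%N then lam (inord i) else 0.
Definition muE (C : fieldType) (m : nat) (mu : 'I_m -> C) (j : nat) : C :=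
  match (insub (j.-1) : option 'I_m) with
  | Some k => if (0 < j)%N then mu k else 0
  | None => 0
  end.

Definition whittaker_vector (C : fieldType) (V : lmodType C)
  (a as_ : int -> V -> V) (n m : nat) (lam : 'I_n.+1 -> C) (mu : 'I_m -> C)
  (w : V) :=
  (forall i : nat, a i%:Z w = lamE lam i *: w) /\
  (forall j : nat, (0 < j)%N -> as_ j%:Z w = muE mu j *: w).

Definition generated_by (C : fieldType) (V : lmodType C)
  (a as_ : int -> V -> V) (w : V) :=
  forall v : V, forall U : V -> Prop, is_subspace U -> U w ->
    (forall r x, U x -> U (a r x)) -> (forall r x, U x -> U (as_ r x)) -> U v.

(* (V, a, a^*, w) is the Whittaker module M_1(lambda, mu) = \hat A / I:
   a Weyl-algebra module generated by a Whittaker vector w, with the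
   universal property of \hat A / I (every Weyl-algebra module with a
   vector w' satisfying the same conditions receives a module map sending
   w to w'). *)
Definition is_whittaker_module (C : fieldType) (V : lmodType C)
  (a as_ : int -> V -> V) (n m : nat) (lam : 'I_n.+1 -> C) (mu : 'I_m -> C)
  (w : V) :=
  [/\ is_weyl_module a as_, whittaker_vector a as_ lam mu w,
      generated_by a as_ w
    & forall (V' : lmodType C) (a' as' : int -> V' -> V') (w' : V'),
        is_weyl_module a' as' -> whittaker_vector a' as' lam mu w' ->
        exists f : V -> V',
          [/\ (forall (c : C) u v, f (c *: u + v) = c *: f u + f v),
              f w = w'
            & forall r v, f (a r v) = a' r (f v) /\ f (as_ r v) = as' r (f v)]].

(* Infinite sums over j in Z of operators that are locally finite:
   zsum F v = \sum_j F j v, defined when only finitely many F j v are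
   nonzero (otherwise an arbitrary junk value 0). *)
Definition zsum_spec (C : fieldType) (V : lmodType C) (F : int -> V -> V)
  (v u : V) :=
  exists N : nat, (forall j : int, (N < `|j|)%N -> F j v = 0) /\
    u = \sum_(k < (N + N).+1) F (k%:Z - N%:Z) v.

Definition zsum (C : fieldType) (V : lmodType C) (F : int -> V -> V) (v : V)
  : V :=
  match excluded_middle_informative (exists u, zsum_spec F v u) with
  | left H => proj1_sig (constructive_indefinite_description _ H)
  | right _ => 0
  end.

Definition nord (C : fieldType) (V : lmodType C) (a as_ : int -> V -> V)
  (p q : int) (v : V) : V :=
  if (0 <= p) && (q <= 0) then as_ q (a p v) else a p (as_ q v).

Definition Eop (C : fieldType) (V : lmodType C) (a as_ : int -> V -> V)
  (ij : int * int) (v : V) : V :=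
  nord a as_ (- ij.1) ij.2 v.

Definition Iop (C : fieldType) (V : lmodType C) (a as_ : int -> V -> V)
  (v : V) : V :=
  zsum (fun j => Eop a as_ (j, j)) v.

Definition Top (C : fieldType) (V : lmodType C) (a as_ : int -> V -> V)
  (rf : int * {poly C}) (v : V) : V :=
  zsum (fun j x => rf.2.[(- j)%:~R] *: nord a as_ (rf.1 - j) j x) v.

Definition Nd (C : fieldType) (V : lmodType C) (a as_ : int -> V -> V)
  (d : C) (w : V) (v : V) : Prop :=
  forall U : V -> Prop, is_subspace U -> invariant (Eop a as_) U ->
    (forall k : nat, U (Iop a as_ (iter k (Iop a as_) w)
                        - d *: iter k (Iop a as_) w)) ->
    U v.

(* Main.v *)
Require Import Defs.
From HB Require Import structures.
From mathcomp Require Import all_boot all_order all_algebra complex.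
From mathcomp Require Import boolp functions reals.
From mathcomp Require Import zify.
Set Implicit Arguments. Unset Strict Implicit. Unset Printing Implicit Defensive.
Import Order.TTheory GRing.Theory Num.Theory.
Local Open Scope ring_scope.

(** Realize the module as polynomials in variables [z_k] ([k] an integer), with
[a(-k)] ([k >= 1]) and [a^*(k)] ([k <= 0]) acting by multiplication and the other
generators as constants plus or minus derivatives.  Fix [lambda_p <> 0] and
[mu_q <> 0].  Since [w] is a multiple of both [a^*(q) w] and [a(p) w], the operators
[E_(i,j)] already generate the module from [w]; as [I] commutes with them,
[N_d] is the image of [I - d].

The multiplication by [z_(-p)] can be eliminated modulo this image, so every class
has a representative independent of [z_(-p)].  An invariant subspace [U] containing
[N_d] meets these polynomials in a space stable under all derivatives: on it
[a(p)] is the scalar [lambda_p], and [a^*(q)], a nonzero scalar minus a locally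
nilpotent operator, is onto.  So if [U] is larger than [N_d] it contains the
constant [w], hence everything.

Finally [w] is not in the image of [I - d]: setting all variables but [y = z_(-p)]
to zero turns [I - d] into [lambda_p y + y d/dy - d], which raises the degree.
The [T_(r,f)] have the same invariant subspaces as the [E_(i,j)] because every
vector meets only finitely many summands, which interpolation separates. *)

(** * Closure properties of subspaces *)

Section Subspaces.
Variables (C : fieldType) (V : lmodType C) (U : V -> Prop).
Hypothesis subU : is_subspace U.

Lemma subspace0 : U 0. Proof. by case: subU. Qed.

Lemma subspaceD u v : U u -> U v -> U (u + v).
Proof. by case: subU => _ + _; exact. Qed.

Lemma subspaceZ c u : U u -> U (c *: u).
Proof. by case: subU => _ _; exact. Qed.

Lemma subspaceB u v : U u -> U v -> U (u - v).
Proof.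
by move=> Uu Uv; rewrite -scaleN1r; apply: subspaceD => //; apply: subspaceZ.
Qed.

Lemma subspace_sum (J : finType) (f : J -> V) :
  (forall j, U (f j)) -> U (\sum_j f j).
Proof.
by move=> Uf; elim/big_ind: _ => //; [exact: subspace0 | exact: subspaceD].
Qed.

End Subspaces.

(** * Sums over symmetric windows of integers *)

Section SymmetricSums.
Variables (C : fieldType) (V : lmodType C).
Implicit Types (f g : int -> V) (N : nat).

Definition isum N f : V := \sum_(k < (N + N).+1) f (k%:Z - N%:Z).

Lemma isumS N f : isum N.+1 f = f (- N.+1%:Z) + isum N f + f N.+1%:Z.
Proof.
rewrite /isum addSn addnS big_ord_recl big_ord_recr /= addrA.
congr (f _ + _ + f _); [by lia | | by rewrite /bump; lia].
by apply: eq_bigr => i _; congr f; rewrite /bump /=; lia.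
Qed.

Lemma isum_widen N M f :
  (N <= M)%N -> (forall j, (N < `|j|)%N -> f j = 0) -> isum M f = isum N f.
Proof.
move=> leNM f0; elim: M leNM => [|M IH]; first by rewrite leqn0 => /eqP ->.
rewrite leq_eqVlt => /predU1P[-> //|ltNM].
rewrite isumS IH // !f0 ?add0r ?addr0 //; by lia.
Qed.

Lemma eq_isum N f g :
  (forall j, (`|j| <= N)%N -> f j = g j) -> isum N f = isum N g.
Proof. by move=> fg; apply: eq_bigr => k _; apply: fg; case: k => k /=; lia. Qed.

Lemma isumD N f g : isum N (fun j => f j + g j) = isum N f + isum N g.
Proof. exact: big_split. Qed.

Lemma isumZ N c f : isum N (fun j => c *: f j) = c *: isum N f.
Proof. by rewrite /isum scaler_sumr. Qed.

Lemma isum_single N f j :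
  (`|j| <= N)%N -> (forall k, k != j -> f k = 0) -> isum N f = f j.
Proof.
move=> leN f0; have lt : (`|(j + N%:Z)%R| < (N + N).+1)%N by lia.
rewrite /isum (bigD1 (Ordinal lt)) //= big1 ?addr0; first by congr f; lia.
by move=> [k lek] /eqP ne; apply: f0; apply: contra_notN ne => /= /eqP E;
   apply: val_inj => /=; lia.
Qed.

Lemma isum_delta N j (x : V) :
  (`|j| <= N)%N -> isum N (fun k => (k == j)%:R *: x) = x.
Proof.
move=> leN; rewrite (isum_single leN) ?eqxx ?scale1r // => k /negbTE ->.
by rewrite scale0r.
Qed.

(** The bound chosen inside [zsum] is unknown, but the smaller of it and [N] widens to the larger
    without changing the sum. Since [N] is a valid bound, the default value 0 does not arise. *)
Lemma zsumE (F : int -> V -> V) v N :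
  (forall j, (N < `|j|)%N -> F j v = 0) -> zsum F v = isum N (F^~ v).
Proof.
move=> F0; rewrite /zsum.
case: ClassicalEpsilon.excluded_middle_informative => [H|[]]; last first.
  by exists (isum N (F^~ v)), N.
case: ClassicalEpsilon.constructive_indefinite_description => u /= [M [FM ->]].
rewrite -/(isum M (F^~ v)).
by have /orP[le|le] := leq_total N M; [|symmetry]; apply: isum_widen.
Qed.

End SymmetricSums.

(** * Rules for linear maps given as bare functions *)

Section LinearMaps.
Variables (C : fieldType) (V W : lmodType C) (g : V -> W).
Hypothesis lin_g : linear g.

Lemma linear_rules : (g 0 = 0) * (forall u v, g (u + v) = g u + g v) *
  (forall u, g (- u) = - g u) * (forall c u, g (c *: u) = c *: g u).
Proof.
pose L := GRing.isLinear.Build C V W *:%R g lin_g.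
pose h : {linear V -> W} := HB.pack g L.
by split; [split; [split|]|] => *; [exact: (linear0 h) | exact: (linearD h)
  | exact: (linearN h) | exact: (linearZ_LR h)].
Qed.

Lemma isum_morph N (f : int -> V) : g (isum N f) = isum N (fun j => g (f j)).
Proof.
by rewrite /isum (big_morph g (id1 := 0) (op1 := +%R)) => [//|? ?|];
  rewrite linear_rules.
Qed.

End LinearMaps.

(** * Commutation relations in a module over the Weyl algebra *)

Section WeylModule.
Variables (C : fieldType) (V : lmodType C) (a as_ : int -> V -> V).
Hypothesis weyl : is_weyl_module a as_.

Lemma a_linear r : linear (a r).
Proof. by case: weyl => H _ _ _ _ ? ? ?; apply: H. Qed.

Lemma as_linear r : linear (as_ r).
Proof. by case: weyl => _ H _ _ _ ? ? ?; apply: H. Qed.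

Let aL r := linear_rules (a_linear r).
Let asL r := linear_rules (as_linear r).

Lemma a_comm r s v : a r (a s v) = a s (a r v).
Proof. by case: weyl. Qed.

Lemma as_comm r s v : as_ r (as_ s v) = as_ s (as_ r v).
Proof. by case: weyl. Qed.

Lemma a_as r s v : a r (as_ s v) = as_ s (a r v) + (r + s == 0)%:R *: v.
Proof. by case: weyl => _ _ _ _ <-; rewrite addrC subrK. Qed.

Lemma a_as_comm r s v : r + s != 0 -> a r (as_ s v) = as_ s (a r v).
Proof. by rewrite a_as => /negbTE ->; rewrite scale0r addr0. Qed.

(** Normal ordering changes the product a(r) a^*(s) by a scalar only, so linearity and commutators
    can be computed on the plain product. *)
Lemma nordE r s v : nord a as_ r s v =
  a r (as_ s v) - ((0 <= r) && (s <= 0) && (r + s == 0))%:R *: v.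
Proof.
rewrite /nord; case: ifP => _ /=; last by rewrite scale0r subr0.
by rewrite a_as addrK.
Qed.

Lemma EopE i j v : Eop a as_ (i, j) v =
  a (- i) (as_ j v) - ((0 <= - i) && (j <= 0) && (- i + j == 0))%:R *: v.
Proof. exact: nordE. Qed.

Lemma Eop_linear ij : linear (Eop a as_ ij).
Proof.
case: ij => i j c u v; rewrite !EopE as_linear a_linear; move: (_%:R) => e.
by rewrite scalerDr scalerBr opprD !scalerA [e * c]mulrC addrACA.
Qed.

Let EL ij := linear_rules (Eop_linear ij).

Lemma Eop_a i j r v : Eop a as_ (i, j) (a r v) =
  a r (Eop a as_ (i, j) v) - (r + j == 0)%:R *: a (- i) v.
Proof.
rewrite !EopE !aL (a_comm r) (a_as r) !aL.
by rewrite [in RHS]addrAC addrK.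
Qed.

Lemma Eop_as i j s v : Eop a as_ (i, j) (as_ s v) =
  as_ s (Eop a as_ (i, j) v) + (s == i)%:R *: as_ j v.
Proof.
rewrite !EopE !asL (as_comm j) a_as addrAC.
by rewrite [- i + s]addrC subr_eq0.
Qed.

(** * Local finiteness and the charge operator I *)

Definition bounded_by N v :=
  forall r : nat, (N < r)%N -> a r%:Z v = 0 /\ as_ r%:Z v = 0.
Definition locally_finite := forall v, exists N, bounded_by N v.

Lemma bounded_a N v r : bounded_by N v -> (N%:Z < r)%R -> a r v = 0.
Proof. by case: r => // r /(_ r) H ltNr; case: H. Qed.

Lemma bounded_as N v r : bounded_by N v -> (N%:Z < r)%R -> as_ r v = 0.
Proof. by case: r => // r /(_ r) H ltNr; case: H. Qed.

Lemma bounded_le N M v : (N <= M)%N -> bounded_by N v -> bounded_by M v.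
Proof. by move=> leNM bN r ltMr; apply: bN; apply: leq_ltn_trans ltMr. Qed.

(** Normal ordering lets an annihilating factor act first: a(r - j) for j very negative, a^*(j) for
    j very positive. *)
Lemma nord_bounded N v r j : bounded_by N v -> (N + `|r| < `|j|)%N ->
  nord a as_ (r - j) j v = 0.
Proof.
move=> bv ltj; rewrite /nord; case: ifP => [/andP[_ le0]|/negbT nle].
  by rewrite (bounded_a bv) ?asL //; lia.
by rewrite (bounded_as bv) ?aL //; lia.
Qed.

Lemma Eop_diag_bounded N v j : bounded_by N v -> (N < `|j|)%N ->
  Eop a as_ (j, j) v = 0.
Proof.
by move=> bv ltj; rewrite /Eop -sub0r (nord_bounded bv) // addn0.
Qed.

Lemma IopE N v : bounded_by N v ->
  Iop a as_ v = isum N (fun j => Eop a as_ (j, j) v).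
Proof. by move=> bv; apply: zsumE => j; apply: Eop_diag_bounded. Qed.

Lemma TopE N r f v : bounded_by N v -> Top a as_ (r, f) v =
  isum (N + `|r|) (fun j => f.[(- j)%:~R] *: Eop a as_ (j - r, j) v).
Proof.
move=> bv; rewrite /Top (@zsumE _ _ _ _ (N + `|r|)) => [|j ltj]; last first.
  by rewrite (nord_bounded bv) // scaler0.
by apply: eq_isum => j _; rewrite /Eop /= opprB.
Qed.

Hypothesis locfin : locally_finite.

Lemma common_bound (u v : V) (n : nat) :
  exists N, [/\ bounded_by N u, bounded_by N v & (n <= N)%N].
Proof.
have [[Nu bu] [Nv bv]] := (locfin u, locfin v).
exists (maxn n (maxn Nu Nv)); split; last exact: leq_maxl.
  by apply: bounded_le bu; lia.
by apply: bounded_le bv; lia.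
Qed.

Lemma Iop_linear : linear (Iop a as_).
Proof.
move=> c u v; have [N [bu bv _]] := common_bound u v 0.
rewrite (IopE bu) (IopE bv) (@IopE N) => [|r ltr].
  by rewrite -isumZ -isumD; apply: eq_isum => j _; rewrite Eop_linear.
by have [au asu] := bu r ltr; have [av asv] := bv r ltr;
  rewrite a_linear as_linear au asu av asv scaler0 addr0.
Qed.

Let IL := linear_rules Iop_linear.

(* [I] is a charge operator: each [a(r)] lowers it by one and each [a^*(r)]
   raises it by one. *)
Lemma Iop_a r v : Iop a as_ (a r v) = a r (Iop a as_ v) - a r v.
Proof.
have [N [bav bv leN]] := common_bound (a r v) v `|r|.
rewrite (IopE bav) (IopE bv) (isum_morph (a_linear r)).
rewrite -[X in _ - X](@isum_delta _ _ N (- r)) ?abszN //.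
rewrite -scaleN1r -isumZ -isumD; apply: eq_isum => j _.
rewrite Eop_a scaleN1r; congr (_ - _).
rewrite addrC addr_eq0; case: eqP => [->|_]; first by rewrite opprK.
by rewrite !scale0r.
Qed.

Lemma Iop_as r v : Iop a as_ (as_ r v) = as_ r (Iop a as_ v) + as_ r v.
Proof.
have [N [bav bv leN]] := common_bound (as_ r v) v `|r|.
rewrite (IopE bav) (IopE bv) (isum_morph (as_linear r)).
rewrite -[X in _ + X](@isum_delta _ _ N r) //.
rewrite -isumD; apply: eq_isum => j _.
rewrite Eop_as; congr (_ + _); rewrite eq_sym; case: eqP => [-> //|_].
by rewrite !scale0r.
Qed.

(** Up to a scalar, E is a product of one a and one a^*, whose charge shifts cancel. *)
Lemma Iop_Eop ij v : Iop a as_ (Eop a as_ ij v) = Eop a as_ ij (Iop a as_ v).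
Proof.
case: ij => i j; rewrite !EopE !IL Iop_a Iop_as !aL.
by rewrite addrK.
Qed.

(** * N_d as the image of I - d *)

Section Quotient.
Variables (w : V) (d : C).
Hypothesis cyclic : forall U : V -> Prop,
  is_subspace U -> Defs.invariant (Eop a as_) U -> U w -> forall v, U v.

(** As I commutes with every E, the image of I - d is invariant and contains the generators of N_d.
    Conversely, for [U] as in the definition of N_d, the vectors u with (I - d) u in [U] form an
    invariant subspace; it contains [w] by the generator with k = 0, hence is everything. *)
Lemma NdP v : Nd a as_ d w v <-> exists u, v = Iop a as_ u - d *: u.
Proof.
split=> [|[u ->] U subU invU Ugen].
- move/(_ (fun x => exists u, x = Iop a as_ u - d *: u)).
  apply=> [|ij _ [u ->]|k]; last by eexists.
  + split; first by exists 0; rewrite IL scaler0 subr0.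
      move=> _ _ [u ->] [v' ->]; exists (u + v').
      by rewrite IL scalerDr opprD addrACA.
    move=> c _ [u ->]; exists (c *: u).
    by rewrite IL scalerBr !scalerA mulrC.
  + by exists (Eop a as_ ij u); rewrite Iop_Eop !EL.
apply: (cyclic (U := fun u => U (Iop a as_ u - d *: u))) => [|ij x Ux|].
- split=> [|x y Ux Uy|c x Ux].
  + by rewrite IL scaler0 subr0; apply: subspace0.
  + by rewrite IL scalerDr opprD addrACA; apply: subspaceD.
  + by rewrite IL scalerA mulrC -scalerA -scalerBr; apply: subspaceZ.
- by rewrite Iop_Eop -(EL ij).2 -(EL ij).1.2 -(EL ij).1.1.2; apply: invU.
- exact: (Ugen 0).
Qed.

End Quotient.

End WeylModule.

(** * Polynomial description of the Whittaker module *)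

Section WhittakerModule.
Variables (C : numFieldType) (V : lmodType C) (a as_ : int -> V -> V).
Variables (L M : nat -> C) (w : V) (B : nat).
Hypothesis weyl : is_weyl_module a as_.
Hypothesis a_w : forall i : nat, a i%:Z w = L i *: w.
Hypothesis as_w : forall j : nat, (0 < j)%N -> as_ j%:Z w = M j *: w.
Hypothesis gen : generated_by a as_ w.
Hypothesis L_finite : forall i, (B < i)%N -> L i = 0.
Hypothesis M_finite : forall j, (B < j)%N -> M j = 0.

Let aL r := linear_rules (a_linear weyl r).
Let asL r := linear_rules (as_linear weyl r).
Let EL ij := linear_rules (Eop_linear weyl ij).

(* In the polynomial model of the module, [w] is the constant 1, [zop k] is
   multiplication by the [k]-th variable and [Dop k] the derivative in it. *)
Definition zop (k : int) v := if 0 < k then a (- k) v else as_ k v.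
Definition Dop (k : int) v :=
  if 0 < k then M `|k| *: v - as_ k v else a (- k) v - L `|k| *: v.

Lemma zop_linear k : linear (zop k).
Proof.
by move=> c u v; rewrite /zop; case: ifP => _; [apply: (a_linear weyl) | apply: (as_linear weyl)].
Qed.

Lemma Dop_linear k : linear (Dop k).
Proof.
move=> c u v; rewrite /Dop; case: ifP => _; rewrite ?(a_linear weyl) ?(as_linear weyl).
  by rewrite scalerDr scalerBr opprD !scalerA mulrC addrACA.
by rewrite scalerDr scalerBr opprD !scalerA mulrC addrACA.
Qed.

Let zL k := linear_rules (zop_linear k).
Let DL k := linear_rules (Dop_linear k).

Lemma zop_a r v : 0 < r -> zop r v = a (- r) v.
Proof. by rewrite /zop => ->. Qed.

Lemma zop_as r v : r <= 0 -> zop r v = as_ r v.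
Proof. by rewrite /zop ltNge => ->. Qed.

Lemma a_Dop (i : nat) v : a i%:Z v = L i *: v + Dop (- i%:Z) v.
Proof. by rewrite /Dop ifF; [rewrite opprK abszN addrC subrK | lia]. Qed.

Lemma as_Dop (j : nat) v : (0 < j)%N -> as_ j%:Z v = M j *: v - Dop j%:Z v.
Proof. by move=> j0; rewrite /Dop ifT; [rewrite opprB addrC subrK | lia]. Qed.

Lemma zop_comm k l v : zop k (zop l v) = zop l (zop k v).
Proof.
rewrite /zop; case: ifP => k0; case: ifP => l0;
  [exact: (a_comm weyl) | | | exact: (as_comm weyl)].
  by rewrite (a_as_comm weyl) //; lia.
by rewrite (a_as_comm weyl) //; lia.
Qed.

Lemma Dop_zop k l v : Dop k (zop l v) = zop l (Dop k v) + (k == l)%:R *: v.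
Proof.
rewrite /Dop /zop; case: ifP => k0; case: ifP => l0.
- have := a_as weyl (- l) k v; rewrite [- l + k]addrC subr_eq0 => E.
  by rewrite !aL E opprD addrA subrK.
- have -> : (k == l) = false by lia.
  by rewrite !asL (as_comm weyl) scale0r addr0.
- have -> : (k == l) = false by lia.
  by rewrite !aL (a_comm weyl) scale0r addr0.
- by rewrite !asL (a_as weyl) addrAC addrC addrC [- k + l]addrC subr_eq0
    (eq_sym l).
Qed.

Lemma Dop_w k : Dop k w = 0.
Proof.
rewrite /Dop; case: ifP => k0.
  by have := as_w (j := `|k|); rewrite gtz0_abs // => ->; [rewrite subrr | lia].
by have := a_w `|k|; rewrite lez0_abs ?leNgt ?k0 // => ->; rewrite subrr.
Qed.

(** The span [S] of the monomials applied to [w] is stable under [Dop], by the Leibniz rule and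
    [Dop_w], hence under all a(r) and a^*(r), so [gen] applies. This serves below as induction on
    polynomials. *)
Lemma zop_generated (U : V -> Prop) : is_subspace U -> U w ->
  (forall k v, U v -> U (zop k v)) -> forall v, U v.
Proof.
move=> subU Uw Uz v.
pose S x := forall X : V -> Prop, is_subspace X -> X w ->
  (forall k v, X v -> X (zop k v)) -> X x.
have subS : is_subspace S.
  split=> [|x y Sx Sy|c x Sx] X subX Xw Xz; first exact: subspace0.
    by apply: subspaceD => //; [apply: Sx | apply: Sy].
  by apply: subspaceZ => //; apply: Sx.
have Sw : S w by [].
have Sz k x : S x -> S (zop k x).
  by move=> Sx X subX Xw Xz; apply: (Xz); apply: Sx.
have SD x : S x -> S x /\ forall k, S (Dop k x).
  move=> Sx; apply: (Sx (fun y => S y /\ forall k, S (Dop k y))); first split.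
  - by split=> [|k]; rewrite ?DL; apply: (subspace0 subS).
  - move=> u u' [Su SDu] [Su' SDu'].
    by split=> [|k]; rewrite ?DL; apply: (subspaceD subS).
  - by move=> c u [Su SDu]; split=> [|k]; rewrite ?DL; apply: (subspaceZ subS).
  - by split=> // k; rewrite Dop_w; apply: (subspace0 subS).
  - move=> k u [Su SDu]; split=> [|l]; first exact: Sz.
    by rewrite Dop_zop; apply: (subspaceD subS) => //; [apply: Sz | apply: (subspaceZ subS)].
suff Sv : S v by apply: Sv.
apply: (@gen v S subS Sw) => r x Sx; have [r0|r0] := ltP 0 r.
- have [i ->] : exists i : nat, r = i%:Z by exists `|r|%N; lia.
  by rewrite a_Dop; apply: (subspaceD subS) => //; [apply: (subspaceZ subS)|apply: (SD _ Sx).2].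
- have [<-|r0'] := eqVneq 0 r.
    rewrite (a_Dop 0); apply: (subspaceD subS) => //; first exact: (subspaceZ subS).
    by apply: (SD _ Sx).2.
  by rewrite -[r]opprK -zop_a; [apply: Sz | lia].
- have [i ri] : exists i : nat, r = i%:Z by exists `|r|%N; lia.
  rewrite ri as_Dop; last by lia.
  by apply: (subspaceB subS) => //; [apply: (subspaceZ subS)|apply: (SD _ Sx).2].
- by rewrite -zop_as //; apply: Sz.
Qed.

(** For r > |k| both a(r) and a^*(r) commute with [zop k], so each multiplication raises the bound
    to at most |k|, starting from [B] for [w]. *)
Lemma whittaker_locally_finite : locally_finite a as_.
Proof.
apply: zop_generated.
- split=> [|u v [Nu bu] [Nv bv]|c u [N bu]].
  + by exists 0%N => r _; rewrite !(aL, asL).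
  + exists (maxn Nu Nv) => r ltr; rewrite !(aL, asL).
    have [|-> ->] := bu r; first by lia.
    by have [|-> ->] := bv r; [lia | rewrite addr0].
  + exists N => r /bu[aru asru]; rewrite !(aL, asL).
    by rewrite aru asru scaler0.
- exists B => r ltr; rewrite a_w as_w; last by lia.
  by rewrite L_finite // M_finite // scale0r.
move=> k u [N bu]; exists (maxn N `|k|) => r ltr.
have [au asu] : a r%:Z u = 0 /\ as_ r%:Z u = 0 by apply: bu; lia.
rewrite /zop; case: ifP => k0; rewrite ?(a_comm weyl r) ?(as_comm weyl r).
  by rewrite -(a_as_comm weyl) ?au ?asu ?aL //; lia.
by rewrite (a_as_comm weyl) ?au ?asu ?asL //; lia.
Qed.

Let locfin := whittaker_locally_finite.

(** * The Euler operator and the common kernel of the derivatives *)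

Definition euler N v := isum N (fun k => zop k (Dop k v)).
(** With E = [euler N], this is (E - 1)...(E - n), which kills the homogeneous polynomials of
    degrees 1 to n in the variables of index at most N in absolute value. *)
Fixpoint euler_prod N n v :=
  if n is m.+1 then euler N (euler_prod N m v) - m.+1%:R *: euler_prod N m v
  else v.

Lemma euler_linear N : linear (euler N).
Proof.
move=> c u v; rewrite /euler -isumZ -isumD; apply: eq_isum => k _.
by rewrite Dop_linear zop_linear.
Qed.

Let euL N := linear_rules (euler_linear N).

Lemma euler_prod_linear N n : linear (euler_prod N n).
Proof.
elim: n => [//|n IH] c u v /=; rewrite IH euler_linear.
move: (_%:R) => e; by rewrite scalerDr scalerBr opprD !scalerA [e * c]mulrC addrACA.
Qed.

Lemma euler_zop N j v : (`|j| <= N)%N ->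
  euler N (zop j v) = zop j (euler N v + v).
Proof.
move=> lej; rewrite zL (isum_morph (zop_linear j)).
rewrite -[X in _ + X](isum_delta _ lej) -isumD; apply: eq_isum => k _.
rewrite Dop_zop zL zop_comm zL; congr (_ + _).
by case: eqP => [->//|_]; rewrite !scale0r.
Qed.

(** Since E z = z (E + 1), moving z_j to the left turns the factors E - 1, ..., E - (n + 1) into E,
    ..., E - n. *)
Lemma euler_prod_zop N n j v : (`|j| <= N)%N ->
  euler_prod N n.+1 (zop j v) = zop j (euler N (euler_prod N n v)).
Proof.
move=> lej; elim: n => [|n IH]; rewrite [euler_prod _ _ (zop _ _)]/=.
  by rewrite euler_zop // zL scale1r addrK.
rewrite [euler N (euler_prod N n (zop j v)) - _]IH euler_zop //= -!zL.
rewrite !(euL, zL); set x := euler N _; set y := zop j (euler N x).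
rewrite -[n.+2%:R]natr1 scalerDl scale1r opprD addrACA.
by rewrite subrr addr0.
Qed.

Lemma euler_prod_eigen N n v : (forall k, Dop k v = 0) ->
  euler_prod N n v = (\prod_(m < n) - m.+1%:R) *: v.
Proof.
move=> Dv0; elim: n => [|n IH] /=; first by rewrite big_ord0 scale1r.
rewrite IH euL big_ord_recr /= {1}/euler (@isum_widen _ _ 0) => [|//|j _]; last first.
  by rewrite Dv0 zL.
rewrite /isum big_ord1 Dv0 zL scaler0 sub0r -scaleNr scalerA.
by rewrite [_ * - _]mulrC.
Qed.

(** Once all variables and degrees of [v] are covered, only its constant term survives. Asking this
    for all large N and n makes the property stable under sums. *)
Lemma euler_prod_to_w v : exists N0 n0, forall N n, (N0 <= N)%N -> (n0 <= n)%N ->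
  exists c, euler_prod N n v = c *: w.
Proof.
move: v; apply: zop_generated.
- split=> [|u v [Nu [nu Hu]] [Nv [nv Hv]]|c u [N0 [n0 Hu]]].
  + exists 0%N, 0%N => N n _ _; exists 0.
    by rewrite (linear_rules (euler_prod_linear N n)) scale0r.
  + exists (maxn Nu Nv), (maxn nu nv) => N n; rewrite !geq_max.
    move=> /andP[lNu lNv] /andP[lnu lnv].
    have [[c Hc] [c' Hc']] := (Hu N n lNu lnu, Hv N n lNv lnv).
    exists (c + c').
    by rewrite (linear_rules (euler_prod_linear N n)) Hc Hc' scalerDl.
  + exists N0, n0 => N n lN ln; have [c' Hc] := Hu N n lN ln; exists (c * c').
    by rewrite (linear_rules (euler_prod_linear N n)) Hc scalerA.
- exists 0%N, 0%N => N n _ _; eexists; apply: euler_prod_eigen.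
  exact: Dop_w.
move=> j v [N0 [n0 Hv]]; exists (maxn N0 `|j|), n0.+1 => N [//|n].
rewrite geq_max => /andP[lN lj] ln; exists 0.
have [c Hc] := Hv N n lN ln.
rewrite euler_prod_zop // Hc euL [euler N w](_ : _ = 0) ?scaler0 ?zL ?scale0r //.
(* The case n = 1 reads (E - 1) w = - w, hence E w = 0. *)
by have := @euler_prod_eigen N 1 w Dop_w; rewrite /= big_ord1 scaleN1r scale1r;
  move/(congr1 (+%R^~ w)); rewrite subrK addNr.
Qed.

(** The product (E - 1)...(E - n) sends [v] to a multiple of [w], but also scales it by (-1)^n n!,
    which is invertible in characteristic 0. *)
Lemma Dop_kernel v : (forall k, Dop k v = 0) -> exists c, v = c *: w.
Proof.
move=> Dv0; have [N [n H]] := euler_prod_to_w v.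
have [c] := H N n (leqnn _) (leqnn _).
rewrite euler_prod_eigen //; set p := \prod_(m < _) _ => Hc.
have p0 : p != 0 by apply/prodf_neq0 => m _; rewrite oppr_eq0 pnatr_eq0.
by exists (p^-1 * c); rewrite -scalerA -Hc scalerA mulVf ?scale1r.
Qed.

(** * Local nilpotence of the derivatives *)

Fixpoint Dop_nilpotent n v :=
  if n is m.+1 then forall k, Dop_nilpotent m (Dop k v) else v = 0.

Lemma Dop_nilpotent_subspace n : is_subspace (Dop_nilpotent n).
Proof.
elim: n => [|n IH] /=.
  by split=> // [_ _ -> ->|c _ ->]; rewrite ?addr0 ?scaler0.
split=> [k|u v Hu Hv k|c u Hu k]; rewrite DL.
- exact: (subspace0 IH).
- exact: (subspaceD IH (Hu k) (Hv k)).
- exact: (subspaceZ IH).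
Qed.

Lemma Dop_nilpotentS n v : Dop_nilpotent n v -> Dop_nilpotent n.+1 v.
Proof.
elim: n v => [v -> k|n IH v Hv k] /=; first by rewrite DL.
exact/IH/Hv.
Qed.

Lemma Dop_nilpotent_le m n v : (m <= n)%N -> Dop_nilpotent m v -> Dop_nilpotent n v.
Proof.
move=> lemn Hv; elim: n lemn => [|n IH]; first by rewrite leqn0 => /eqP <-.
by rewrite leq_eqVlt => /predU1P[<- //|/IH]; apply: Dop_nilpotentS.
Qed.

Lemma Dop_nilpotent_zop n k v :
  Dop_nilpotent n v -> Dop_nilpotent n.+1 (zop k v).
Proof.
elim: n k v => [k v -> l|n IH k v Hv l]; first by rewrite zL DL.
have sub := Dop_nilpotent_subspace n.+1.
by rewrite Dop_zop; apply: (subspaceD sub); [exact/IH/Hv | exact: (subspaceZ sub)].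
Qed.

Lemma Dop_locally_nilpotent v : exists n, Dop_nilpotent n v.
Proof.
move: v; apply: zop_generated.
- split=> [|u v [m Hu] [n Hv]|c u [n Hu]]; first by exists 0%N.
    exists (maxn m n); apply: (subspaceD (Dop_nilpotent_subspace _)).
      by apply: Dop_nilpotent_le Hu; apply: leq_maxl.
    by apply: Dop_nilpotent_le Hv; apply: leq_maxr.
  by exists n; apply: (subspaceZ (Dop_nilpotent_subspace _)).
- by exists 1%N => k; apply: Dop_w.
- by move=> k v [n Hv]; exists n.+1; apply: Dop_nilpotent_zop.
Qed.

(** Differentiate [u] as long as some derivative is nonzero; the last vector lies in the common
    kernel, so it is a nonzero multiple of [w]. *)
Lemma Dop_stable_w (X : V -> Prop) u : is_subspace X ->
  (forall k v, X v -> X (Dop k v)) -> X u -> u <> 0 -> X w.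
Proof.
move=> subX XD; have [n] := Dop_locally_nilpotent u.
elim: n u => [u -> //|n IH u Hu Xu u0].
have [Du0|/existsNP[k Dk]] := pselect (forall k, Dop k u = 0); last first.
  exact: (IH (Dop k u)) (XD _ _ Xu) Dk.
have [c uw] := Dop_kernel Du0.
have c0 : c != 0 by apply: contra_notN u0 => /eqP c0; rewrite uw c0 scale0r.
have -> : w = c^-1 *: u by rewrite uw scalerA mulVf ?scale1r.
exact: subspaceZ.
Qed.

(** * The image of I - d and elimination of z_(-p) *)

Variable p : nat.
Hypothesis Lp : L p != 0.

Definition charge_image d v := exists u, v = Iop a as_ u - d *: u.

Let IL := linear_rules (Iop_linear weyl locfin).

Lemma charge_image_subspace d : is_subspace (charge_image d).
Proof.
split; first by exists 0; rewrite IL scaler0 subr0.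
  move=> _ _ [u ->] [v ->]; exists (u + v).
  by rewrite IL scalerDr opprD addrACA.
move=> c _ [u ->]; exists (c *: u).
by rewrite IL scalerBr !scalerA mulrC.
Qed.

(** This is (I - d) a(r) = a(r) (I - (d + 1)). *)
Lemma charge_image_a d r v : charge_image (d + 1) v -> charge_image d (a r v).
Proof.
move=> [u ->]; exists (a r u).
rewrite (Iop_a weyl locfin) !aL scalerDl scale1r.
by rewrite opprD addrA addrAC.
Qed.

Lemma charge_image_as d r v : charge_image (d - 1) v -> charge_image d (as_ r v).
Proof.
move=> [u ->]; exists (as_ r u).
rewrite (Iop_as weyl locfin) !asL scalerBl scale1r.
by rewrite opprB addrCA addrA addrAC addrC addrA.
Qed.

(** As a(p) is [L p] plus the derivative in z_(-p), these are the polynomials independent of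
    z_(-p). *)
Definition a_eigen v := a p v = L p *: v.

Lemma a_eigen_subspace : is_subspace a_eigen.
Proof.
split=> [|u v Eu Ev|c u Eu]; rewrite /a_eigen !aL ?scaler0 //.
  by rewrite Eu Ev scalerDr.
by rewrite Eu !scalerA mulrC.
Qed.

Lemma a_eigen_a r v : a_eigen v -> a_eigen (a r v).
Proof. by rewrite /a_eigen (a_comm weyl) => ->; rewrite aL. Qed.

Lemma a_eigen_as r v : r != - p%:Z -> a_eigen v -> a_eigen (as_ r v).
Proof.
move=> rp; rewrite /a_eigen (a_as_comm weyl) //; last by rewrite addrC addr_eq0.
by move=> ->; rewrite asL.
Qed.

(* Solve [(I - d) k = lambda_p a^*(-p) k + (a term again killed by
   a(p) - lambda_p)] for [a^*(-p) k]. *)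
Lemma a_eigen_complement d v :
  exists2 k, a_eigen k & charge_image d (v - k).
Proof.
have subE := a_eigen_subspace.
(* The induction treats all [d] at once because the generators shift [d] by one. *)
move: d; apply: (@gen v (fun v => forall d, exists2 k, a_eigen k &
  charge_image d (v - k))) => [|d|r x Hx d|r x Hx d].
- split=> [d|x y Hx Hy d|c x Hx d].
  + exists 0; first exact: (subspace0 subE).
    by rewrite subr0; apply: (subspace0 (charge_image_subspace d)).
  + have [[k Ek Ik] [l El Il]] := (Hx d, Hy d).
    exists (k + l); first exact: (subspaceD subE).
    rewrite opprD addrACA.
    exact: (subspaceD (charge_image_subspace d)).
  + have [k Ek Ik] := Hx d; exists (c *: k); first exact: (subspaceZ subE).
    by rewrite -scalerBr; apply: (subspaceZ (charge_image_subspace d)).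
- exists w; first exact: a_w.
  by rewrite subrr; apply: (subspace0 (charge_image_subspace d)).
- have [k Ek Ik] := Hx (d + 1); exists (a r k); first exact: a_eigen_a.
  have -> : a r x - a r k = a r (x - k) by rewrite !aL.
  exact: charge_image_a.
have [k Ek Ik] := Hx (d - 1).
have {}Ik : charge_image d (as_ r x - as_ r k).
  have -> : as_ r x - as_ r k = as_ r (x - k) by rewrite !asL.
  exact: charge_image_as.
have [rp|rp] := eqVneq r (- p%:Z); last first.
  by exists (as_ r k) => //; apply: a_eigen_as.
suff [l El Il] : exists2 l, a_eigen l & charge_image d (as_ r k - l).
  exists l => //.
  have -> : as_ r x - l = as_ r x - as_ r k + (as_ r k - l).
    by rewrite addrA subrK.
  exact: (subspaceD (charge_image_subspace d)).
have [N [bk _ leN]] := common_bound locfin k k p.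
(* Only the summand j = -p of I can leave [a_eigen]. Its normal ordering is a^*(-p) a(p), which
   gives [L p] times a^*(-p) k. *)
pose f j := if j == - p%:Z then 0 else Eop a as_ (j, j) k.
have Ef : a_eigen (isum N f - d *: k).
  apply: (subspaceB subE); last exact: (subspaceZ subE).
  apply: (subspace_sum subE) => j; rewrite /f; case: eqP => [_|/eqP jp].
    exact: (subspace0 subE).
  rewrite (EopE weyl); apply: (subspaceB subE); last exact: (subspaceZ subE).
  exact/a_eigen_a/a_eigen_as.
have If : Iop a as_ k = L p *: as_ r k + isum N f.
  rewrite (IopE weyl bk).
  rewrite -[L p *: _](@isum_delta _ _ N (- p%:Z)) ?abszN // -isumD.
  apply: eq_isum => j _; rewrite /f; case: eqP => [->|_].
    rewrite scale1r addr0 /Eop /nord /= opprK ifT; last by lia.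
    by rewrite Ek asL rp.
  by rewrite scale0r add0r.
exists ((- (L p)^-1) *: (isum N f - d *: k)); first exact: (subspaceZ subE).
exists ((L p)^-1 *: k).
rewrite IL If scaleNr opprK scalerBr scalerDr !scalerA mulVf // scale1r.
by rewrite addrA [d * _]mulrC.
Qed.

(** Here [phi k] abstracts the coefficient of y^k, y = z_(-p), after setting the other variables to
    zero. If w = (I - d) u, comparing coefficients forces every [phi k u] to vanish, while the
    constant term of [w] is 1. *)
Lemma charge_functional_not_image d (phi : nat -> V -> C) :
  (forall k, linear (phi k : V -> C^o)) ->
  (forall k j v, j != - p%:Z -> phi k (zop j v) = 0) ->
  (forall v, phi 0%N (zop (- p%:Z) v) = 0) ->
  (forall k v, phi k.+1 (zop (- p%:Z) v) = phi k v) ->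
  (forall k v, phi k (Dop (- p%:Z) v) = k.+1%:R * phi k.+1 v) ->
  (forall k, phi k w = (k == 0)%:R) ->
  ~ charge_image d w.
Proof.
move=> phi_lin phi_z phi_z0 phi_zS phi_D phi_w [u wE].
have phiL k := linear_rules (phi_lin k).
have [K uK] : exists K, forall k, (K < k)%N -> phi k u = 0.
  move: u {wE}; apply: zop_generated.
  - split=> [|x y [Kx Hx] [Ky Hy]|c x [Kx Hx]].
    + by exists 0%N => k _; rewrite phiL.
    + exists (maxn Kx Ky) => k; rewrite gtn_max => /andP[kx ky].
      by rewrite phiL Hx ?Hy ?addr0.
    + by exists Kx => k kx; rewrite phiL Hx ?scaler0.
  - by exists 0%N => -[//|k] _; rewrite phi_w.
  - move=> j x [Kx Hx]; have [->|jp] := eqVneq j (- p%:Z).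
      by exists Kx.+1 => -[//|k] kx; rewrite phi_zS Hx.
    by exists 0%N => k _; rewrite phi_z.
have [N [bu _ leN]] := common_bound locfin u u p.
(* Each normally ordered summand E_(j,j) ends with multiplication by z_j, which [phi k] kills unless
   j = -p. *)
have phi_I k : phi k (Iop a as_ u) = phi k (zop (- p%:Z) (a p u)).
  rewrite (IopE weyl bu) (isum_morph (phi_lin k)).
  rewrite (@isum_single _ _ _ _ (- p%:Z)) ?abszN //.
    by rewrite /Eop /nord /= opprK ifT ?zop_as //; lia.
  move=> j jp; rewrite /Eop /nord /=; case: ifP => [/andP[_ j0]|j0].
    by rewrite -zop_as // phi_z.
  by rewrite -zop_a ?phi_z //; lia.
have rec k : phi k.+1 w = L p * phi k u + (k.+1%:R - d) * phi k.+1 u.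
  rewrite wE !phiL phi_I phi_zS a_Dop !phiL phi_D.
  by rewrite mulrBl addrA.
have phi_u k : phi k u = 0.
  (* Descending induction on [k] from above [K]: as [L p] is nonzero, [rec] determines [phi k u]
     from [phi k.+1 u]. *)
  have H n : (K < k + n)%N -> phi k u = 0.
    elim: n k => [|n IH] k; first by rewrite addn0 => /uK.
    rewrite addnS -addSn => /IH k1; have := rec k.
    by rewrite k1 phi_w mulr0 addr0 => /esym/eqP; rewrite mulf_eq0 (negbTE Lp) => /eqP.
  by apply: (H K.+1); rewrite addnS ltnS leq_addl.
have := phi_w 0%N; rewrite wE !phiL phi_I phi_z0 phi_u scaler0 subr0 => /esym/eqP.
by rewrite oner_eq0.
Qed.

(** * Cyclicity and irreducibility under the E_(i,j) *)

Variable q : nat.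
Hypotheses (q_gt0 : (0 < q)%N) (Mq : M q != 0).

(* [a(r) w] is a multiple of [a(r) a^*(q) w], and [a(r) a^*(q)] is, up to a
   scalar, one of the [E_(i,j)]; similarly for [a^*(r) w]. *)
Lemma Eop_cyclic (U : V -> Prop) : is_subspace U ->
  Defs.invariant (Eop a as_) U -> U w -> forall v, U v.
Proof.
move=> subU invU Uw v.
pose S x := forall X : V -> Prop, is_subspace X ->
  Defs.invariant (Eop a as_) X -> X w -> X x.
have subS : is_subspace S.
  split=> [|x y Sx Sy|c x Sx] X subX invX Xw; first exact: subspace0.
    by apply: subspaceD => //; [apply: Sx | apply: Sy].
  by apply: subspaceZ => //; apply: Sx.
have invS : Defs.invariant (Eop a as_) S.
  by move=> ij x Sx X subX invX Xw; apply: (invX); apply: Sx.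
have Sw : S w by [].
have Sa_as r s x : S x -> S (a r (as_ s x)).
  move=> Sx; have := EopE weyl (- r) s x; rewrite opprK => /eqP.
  rewrite eq_sym subr_eq => /eqP ->.
  by apply: (subspaceD subS); [apply: invS | apply: (subspaceZ subS)].
have Sas_a r s x : S x -> S (as_ s (a r x)).
  move=> Sx; have /eqP := a_as weyl r s x; rewrite -subr_eq => /eqP <-.
  by apply: (subspaceB subS); [apply: Sa_as | apply: (subspaceZ subS)].
suff Sx_aas x : S x -> (forall r, S (a r x)) /\ (forall r, S (as_ r x)).
  have Sv : S v by apply: (@gen v S subS Sw) => r x /Sx_aas[].
  exact: Sv.
(* Commutators of E with generators are multiples of generators, so this condition on y is
   E-invariant and only y = [w] needs the nonzero parameters. *)
move=> Sx; apply: (Sx (fun y => (forall r, S (a r y)) /\ forall r, S (as_ r y))).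
- split=> [|y z [y1 y2] [z1 z2]|c y [y1 y2]]; split=> r; rewrite !(aL, asL).
  + exact: (subspace0 subS).
  + exact: (subspace0 subS).
  + exact: (subspaceD subS).
  + exact: (subspaceD subS).
  + exact: (subspaceZ subS).
  + exact: (subspaceZ subS).
- move=> [i j] y [y1 y2]; split=> r.
  + have /eqP := Eop_a weyl i j r y; rewrite eq_sym subr_eq => /eqP ->.
    by apply: (subspaceD subS); [apply: invS | apply: (subspaceZ subS)].
  + have /eqP := Eop_as weyl i j r y; rewrite -subr_eq => /eqP <-.
    by apply: (subspaceB subS); [apply: invS | apply: (subspaceZ subS)].
- split=> r.
  + have -> : a r w = (M q)^-1 *: a r (as_ q w).
      by rewrite as_w // aL scalerA mulVf ?scale1r.
    by apply: (subspaceZ subS); apply: Sa_as.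
  + have -> : as_ r w = (L p)^-1 *: as_ r (a p w).
      by rewrite a_w asL scalerA mulVf ?scale1r.
    by apply: (subspaceZ subS); apply: Sas_a.
Qed.

(** For j > 0, E_(-p,j) acts on such vectors as [L p] times a^*(j). For a(-k) with k <= 0, write u =
    a^*(q) u' inside the same space; then a(-k) u = E_(k,q) u'. *)
Lemma cut_Dop (U : V -> Prop) : is_subspace U ->
  Defs.invariant (Eop a as_) U ->
  forall k u, U u /\ a_eigen u -> U (Dop k u) /\ a_eigen (Dop k u).
Proof.
move=> subU invU; have subE := a_eigen_subspace.
have as_closed (j : nat) u : (0 < j)%N -> U u -> a_eigen u ->
    U (as_ j u) /\ a_eigen (as_ j u).
  move=> j0 Uu Eu; split; last by apply: a_eigen_as => //; lia.
  have : U (Eop a as_ (- p%:Z, j%:Z) u) by exact: invU.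
  rewrite (EopE weyl) opprK (a_as_comm weyl); last by lia.
  have -> : (j%:Z <= 0) = false by lia.
  rewrite andbF scale0r subr0 Eu asL => /(subspaceZ subU (L p)^-1).
  by rewrite scalerA mulVf ?scale1r.
(* Solve a^*(q) u1 = D_q u by induction on nilpotency; since a^*(q) u + D_q u = [M q] u, the
   preimage of u is (u + u1) / [M q]. *)
have as_onto n u : U u -> a_eigen u -> Dop_nilpotent n u ->
    exists u', [/\ U u', a_eigen u' & as_ q u' = u].
  elim: n u => [u _ _ ->|n IH u Uu Eu /(_ q%:Z) Du].
    by exists 0; rewrite asL; split=> //; [exact: subspace0|exact: (subspace0 subE)].
  have [Uas Eas] := as_closed q u q_gt0 Uu Eu.
  have uE : u = (M q)^-1 *: (as_ q u + Dop q u).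
    by rewrite as_Dop // subrK scalerA mulVf ?scale1r.
  have DE : Dop q u = M q *: u - as_ q u by rewrite /Dop ifT.
  have [||u1 [Uu1 Eu1 u1E]] := IH (Dop q u) _ _ Du.
  - by rewrite DE; apply: (subspaceB subU) => //; apply: (subspaceZ subU).
  - by rewrite DE; apply: (subspaceB subE) => //; apply: (subspaceZ subE).
  exists ((M q)^-1 *: (u + u1)); split.
  - by apply: (subspaceZ subU); apply: (subspaceD subU).
  - by apply: (subspaceZ subE); apply: (subspaceD subE).
  - by rewrite !asL u1E -uE.
move=> k u [Uu Eu]; rewrite /Dop; case: ifP => k0.
  have [kn ->] : exists kn : nat, k = kn.+1%:Z by exists `|k|.-1; lia.
  have [Uas Eas] := as_closed kn.+1 u isT Uu Eu.
  by split; [apply: (subspaceB subU) => //; apply: (subspaceZ subU)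
            |apply: (subspaceB subE) => //; apply: (subspaceZ subE)].
have Ea : a_eigen (a (- k) u) by exact: a_eigen_a.
split; last by apply: (subspaceB subE) => //; apply: (subspaceZ subE).
apply: (subspaceB subU); last exact: (subspaceZ subU).
have [n Du] := Dop_locally_nilpotent u.
have [u' [Uu' Eu' <-]] := as_onto n u Uu Eu Du.
have := invU (k, q%:Z) u' Uu'; rewrite (EopE weyl).
have -> : (q%:Z <= 0) = false by lia.
by rewrite andbF scale0r subr0.
Qed.

Lemma Nd_irreducible d : ~ charge_image d w ->
  irreducible_quotient (Eop a as_) (Nd a as_ d w).
Proof.
have NP v : Nd a as_ d w v <-> charge_image d v.
  exact: (NdP weyl locfin d Eop_cyclic).
move=> Iw; split=> [ij v Nv U subU invU Ugen||U subU NU invU].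
- exact: (invU _ _ (Nv U subU invU Ugen)).
- by exists w => /NP.
have [UN|/existsNP[v /not_implyP[Uv Nv]]] := pselect (forall v, U v -> Nd a as_ d w v).
  by left.
right; apply: Eop_cyclic => //.
(* This representative [k] of [v] modulo N_d stays in [U], and is nonzero because [v] is outside
   N_d. *)
have [k Ek Ik] := a_eigen_complement d v.
have Uk : U k.
  rewrite -[k](subKr v); apply: (subspaceB subU) => //.
  by apply: NU; apply/NP.
have subX : is_subspace (fun u => U u /\ a_eigen u).
  have subE := a_eigen_subspace.
  split=> [|x y [Ux Ex] [Uy Ey]|c x [Ux Ex]].
  - by split; [exact: subspace0 | exact: (subspace0 subE)].
  - by split; [exact: subspaceD | exact: (subspaceD subE)].
  - by split; [exact: subspaceZ | exact: (subspaceZ subE)].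
have [] // := @Dop_stable_w (fun u => U u /\ a_eigen u) k subX (cut_Dop subU invU).
by move=> k0; apply/Nv/NP; rewrite -[v]subr0 -k0.
Qed.

End WhittakerModule.

(** * Comparing invariance under the T_(r,f) and the E_(i,j) *)

Section TopInvariance.
Variables (C : numFieldType) (V : lmodType C) (a as_ : int -> V -> V).
Hypothesis locfin : locally_finite a as_.
Hypothesis weyl : is_weyl_module a as_.

Lemma Eop_invariant_Top (U : V -> Prop) : is_subspace U ->
  Defs.invariant (Eop a as_) U -> Defs.invariant (Top a as_) U.
Proof.
move=> subU invU [r f] v Uv; have [N bv] := locfin v.
rewrite (TopE weyl r f bv); apply: (subspace_sum subU) => k.
by apply: (subspaceZ subU); apply: invU.
Qed.

(* Choosing [f] to vanish at all the relevant points but one isolates a single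
   summand of [T_(r,f) v]. *)
Lemma Top_invariant_Eop (U : V -> Prop) : is_subspace U ->
  Defs.invariant (Top a as_) U -> Defs.invariant (Eop a as_) U.
Proof.
move=> subU invU [i j] v Uv.
have [N [bv _ leN]] := common_bound locfin v v `|j|.
(* [K] is the window of [TopE] for r = j - i, and it contains j since N >= |j|. In characteristic 0
   the roots of [f] stay distinct from -j. *)
pose K := (N + `|j - i|)%N; pose x (k : 'I_(K + K).+1) := k%:Z - K%:Z.
pose f : {poly C} := \prod_(k | x k != j) ('X + (x k)%:~R%:P).
have fj : f.[(- j)%:~R] != 0.
  rewrite horner_prod; apply/prodf_neq0 => k xk.
  by rewrite !hornerE -intrD intr_eq0 addrC subr_eq0.
have f0 l : (`|l| <= K)%N -> l != j -> f.[(- l)%:~R] = 0.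
  move=> leK lj; have lt : (`|(l + K%:Z)%R| < (K + K).+1)%N by lia.
  have xl : x (Ordinal lt) = l by rewrite /x /=; lia.
  rewrite horner_prod (bigD1 (Ordinal lt)) ?xl //=.
  by rewrite !hornerE -intrD addNr mul0r.
have TE : Top a as_ (j - i, f) v = f.[(- j)%:~R] *: Eop a as_ (i, j) v.
  rewrite (TopE weyl _ _ bv).
  rewrite -[Eop a as_ (i, j) v](@isum_delta _ _ K j); last by lia.
  rewrite -isumZ; apply: eq_isum => l leK; have [->|lj] := eqVneq l j.
    by rewrite scale1r subKr.
  by rewrite (f0 l) // !scale0r scaler0.
have -> : Eop a as_ (i, j) v = f.[(- j)%:~R]^-1 *: Top a as_ (j - i, f) v.
  by rewrite TE scalerA mulVf ?scale1r.
by apply: (subspaceZ subU); apply: invU.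
Qed.

Lemma Nd_subspace d w : is_subspace (Nd a as_ d w).
Proof.
split=> [|x y Nx Ny|c x Nx] U subU invU gen.
- exact: subspace0.
- by apply: (subspaceD subU); [apply: Nx | apply: Ny].
- by apply: (subspaceZ subU); apply: Nx.
Qed.

Lemma irreducible_quotient_Top N : is_subspace N ->
  irreducible_quotient (Eop a as_) N -> irreducible_quotient (Top a as_) N.
Proof.
move=> subN [invN properN maxN]; split=> //.
  exact: Eop_invariant_Top.
by move=> U subU NU invU; apply: maxN => //; apply: Top_invariant_Eop.
Qed.

End TopInvariance.

(** * A formal power series model with a Whittaker vector *)

Section PowerSeriesModel.
Variables (C : numFieldType) (L M : nat -> C).

(* Functions of an arbitrary exponent [int -> nat] are formal sums of monomials
   in variables indexed by [int]; no finiteness is imposed, so that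
   multiplication and differentiation are given by pointwise formulas. *)
Definition series := (int -> nat) -> C^o.
Implicit Types (c : series) (e : int -> nat).

Definition shift (k : int) (h : nat -> nat) e : int -> nat :=
  fun j => if j == k then h (e j) else e j.

Lemma shift_id k h e : h (e k) = e k -> shift k h e = e.
Proof. by move=> hk; apply/funext => j; rewrite /shift; case: eqP => [->|]. Qed.

Lemma shiftC k l h g e : k != l ->
  shift k h (shift l g e) = shift l g (shift k h e).
Proof.
move=> kl; apply/funext => j; rewrite /shift.
by case: eqP => [->|//]; rewrite (negbTE kl).
Qed.

Lemma shiftM k h g e : shift k h (shift k g e) = shift k (h \o g) e.
Proof. by apply/funext => j; rewrite /shift /=; case: eqP. Qed.

Lemma shift_neq k l h e : k != l -> shift k h e l = e l.
Proof. by rewrite /shift eq_sym => /negbTE ->. Qed.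

Lemma shift_eq k h e : shift k h e k = h (e k).
Proof. by rewrite /shift eqxx. Qed.

Definition var k c : series :=
  fun e => if e k is 0%N then 0 else c (shift k predn e).
Definition der k c : series := fun e => (e k).+1%:R * c (shift k succn e).

Lemma var_linear k : linear (var k).
Proof.
move=> b c c'; apply/funext => e; rewrite /var !fctE.
by case: (e k) => //; rewrite scaler0 addr0.
Qed.

Lemma der_linear k : linear (der k).
Proof.
move=> b c c'; apply/funext => e; rewrite /der !fctE.
by rewrite mulrDr; congr (_ + _); rewrite /GRing.scale /= mulrCA.
Qed.

Lemma var_comm k l c : var k (var l c) = var l (var k c).
Proof.
have [-> //|kl] := eqVneq k l; have lk : l != k by rewrite eq_sym.
apply/funext => e; rewrite /var !shift_neq // shiftC //.
by case: (e k); case: (e l).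
Qed.

Lemma der_comm k l c : der k (der l c) = der l (der k c).
Proof.
have [-> //|kl] := eqVneq k l; have lk : l != k by rewrite eq_sym.
by apply/funext => e; rewrite /der !shift_neq // shiftC // mulrCA.
Qed.

Lemma der_var k l c : der k (var l c) = var l (der k c) + (k == l)%:R *: c.
Proof.
apply/funext => e; rewrite !fctE /der /var; have [->|kl] := eqVneq k l.
  rewrite shift_eq !shiftM scale1r shift_id //= shift_eq.
  case E : (e l) => [|n]; first by rewrite mul1r add0r.
  rewrite (@shift_id l (succn \o predn)) /= ?E //.
  by rewrite -[in LHS]natr1 mulrDl mul1r.
have lk : l != k by rewrite eq_sym.
rewrite scale0r addr0 (@shift_neq k l) // (@shiftC l k) // (@shift_neq l k) //.
by case: (e l) => //; rewrite mulr0.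
Qed.

Definition one : series := fun e => (e == (fun=> 0%N))%:R.

Lemma der_one k : der k one = 0.
Proof.
apply/funext => e; rewrite /der /one; case: eqP => [/(congr1 (@^~ k))|_].
  by rewrite shift_eq.
by rewrite mulr0.
Qed.

(** The derivative enters with a plus sign here and a minus sign in [asM], so that [a(r), a^*(-r)] =
    1 for either sign of r. *)
Definition aM (r : int) c : series :=
  if r < 0 then var (- r) c else L `|r| *: c + der (- r) c.
Definition asM (r : int) c : series :=
  if r <= 0 then var r c else M `|r| *: c - der r c.

Let vL k := linear_rules (var_linear k).
Let dL k := linear_rules (der_linear k).

Lemma series_weyl : is_weyl_module aM asM.
Proof.
split.
- move=> r b c c'; rewrite /aM; case: ifP => _; first exact: var_linear.
  by rewrite der_linear !scalerDr addrACA !scalerA [b * _]mulrC.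
- move=> r b c c'; rewrite /asM; case: ifP => _; first exact: var_linear.
  rewrite der_linear opprD !scalerDr addrACA !scalerA [b * _]mulrC.
  by rewrite scalerN.
- move=> r s c; rewrite /aM; case: ifP => r0; case: ifP => s0.
  + exact: var_comm.
  + by rewrite !vL der_var (_ : (_ == _) = false) ?scale0r ?addr0 //; lia.
  + by rewrite !vL der_var (_ : (_ == _) = false) ?scale0r ?addr0 //; lia.
  + by rewrite !dL !scalerDr der_comm !scalerA [L _ * _]mulrC addrACA.
- move=> r s c; rewrite /asM; case: ifP => r0; case: ifP => s0.
  + exact: var_comm.
  + by rewrite !vL der_var (_ : (_ == _) = false) ?scale0r ?addr0 //; lia.
  + by rewrite !vL der_var (_ : (_ == _) = false) ?scale0r ?addr0 //; lia.
  + rewrite !dL !scalerDr !opprD !scalerN !opprK der_comm !scalerA.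
    by rewrite [M _ * _]mulrC !addrA; congr (_ + _); rewrite addrAC.
- move=> r s c; rewrite /aM /asM; case: ifP => r0; case: ifP => s0.
  + by rewrite var_comm subrr (_ : (_ == _) = false) ?scale0r //; lia.
  + rewrite !vL der_var opprB addrC addrA subrK addrAC subrr add0r.
    by rewrite addrC addr_eq0.
  + rewrite !vL der_var opprD addrACA subrr add0r addrAC subrr add0r.
    by rewrite [r + s]addrC addr_eq0 eq_sym.
  + rewrite (_ : (_ == _) = false) ?scale0r; last by lia.
    apply/eqP; rewrite subr_eq0; apply/eqP.
    rewrite !dL !scalerDr !opprD !scalerN der_comm !scalerA [L _ * _]mulrC.
    by rewrite -!addrA; congr (_ + _); rewrite addrCA.
Qed.

Lemma series_whittaker :
  (forall i : nat, aM i%:Z one = L i *: one) /\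
  (forall j : nat, (0 < j)%N -> asM j%:Z one = M j *: one).
Proof.
split=> [i|j j0]; rewrite /aM /asM ?der_one ?addr0 //.
by rewrite ifF ?subr0 //; lia.
Qed.

Lemma aM_var r c : r < 0 -> aM r c = var (- r) c.
Proof. by rewrite /aM => ->. Qed.

Lemma asM_var r c : r <= 0 -> asM r c = var r c.
Proof. by rewrite /asM => ->. Qed.

Lemma aM_der (i : nat) c : aM i%:Z c = L i *: c + der (- i%:Z) c.
Proof. by []. Qed.

(** Evaluating a series here reads off the coefficient of z_(k0)^k, as if all other variables were
    set to zero. *)
Definition pure_power (k0 : int) (k : nat) : int -> nat :=
  fun j => if j == k0 then k else 0%N.

Lemma var_pure_neq k0 k j c : j != k0 -> var j c (pure_power k0 k) = 0.
Proof. by rewrite /var /pure_power => /negbTE ->. Qed.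

Lemma shift_pure k0 k h :
  shift k0 h (pure_power k0 k) = pure_power k0 (h k).
Proof. by apply/funext => j; rewrite /shift /pure_power; case: eqP. Qed.

Lemma var_pure k0 k c :
  var k0 c (pure_power k0 k) = if k is n.+1 then c (pure_power k0 n) else 0.
Proof. by rewrite /var shift_pure /pure_power eqxx; case: k. Qed.

Lemma der_pure k0 k c :
  der k0 c (pure_power k0 k) = k.+1%:R * c (pure_power k0 k.+1).
Proof. by rewrite /der shift_pure {1}/pure_power eqxx. Qed.

Lemma one_pure k0 k : one (pure_power k0 k) = (k == 0)%:R.
Proof.
rewrite /one; congr (nat_of_bool _)%:R; apply/eqP/eqP => [|->].
  by move/(congr1 (@^~ k0)); rewrite /pure_power eqxx.
by apply/funext => j; rewrite /pure_power; case: ifP.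
Qed.

End PowerSeriesModel.

(** * Whittaker parameters and the final assembly *)

Lemma lamE_ord (C : fieldType) n (lam : 'I_n.+1 -> C) (k : 'I_n.+1) :
  lamE lam k = lam k.
Proof. by rewrite /lamE ltn_ord inord_val. Qed.

Lemma lamE_out (C : fieldType) n (lam : 'I_n.+1 -> C) i :
  (n < i)%N -> lamE lam i = 0.
Proof. by rewrite /lamE ltnS ltnNge => /negbTE ->. Qed.

Lemma muE_ord (C : fieldType) m (mu : 'I_m -> C) (k : 'I_m) :
  muE mu k.+1 = mu k.
Proof. by rewrite /muE /= valK. Qed.

Lemma muE_out (C : fieldType) m (mu : 'I_m -> C) j :
  (m < j)%N -> muE mu j = 0.
Proof. by case: j => // j mj; rewrite /muE insubF //=; lia. Qed.

Lemma whittaker_irreducible (C : numFieldType) (n m : nat)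
  (lam : 'I_n.+1 -> C) (mu : 'I_m -> C)
  (hlam : exists k, lam k != 0) (hmu : exists k, mu k != 0)
  (V : lmodType C) (a as_ : int -> V -> V) (w : V)
  (hV : is_whittaker_module a as_ lam mu w) (d : C) :
  irreducible_quotient (Eop a as_) (Nd a as_ d w) /\
  irreducible_quotient (Top a as_) (Nd a as_ d w).
Proof.
case: hV => weyl [a_w as_w] gen univ; case: hlam => p0 lp; case: hmu => q0 mq.
have Lp : lamE lam p0 != 0 by rewrite lamE_ord.
(* The mu_j are numbered from 1, so the ordinal [q0] stands for q = [q0.+1]. *)
have Mq : muE mu q0.+1 != 0 by rewrite muE_ord.
have Lf i : (n + m < i)%N -> lamE lam i = 0.
  by move=> ni; apply: lamE_out; apply: leq_ltn_trans ni; apply: leq_addr.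
have Mf i : (n + m < i)%N -> muE mu i = 0.
  by move=> ni; apply: muE_out; apply: leq_ltn_trans ni; apply: leq_addl.
have locfin := whittaker_locally_finite weyl a_w as_w gen Lf Mf.
suff irrE : irreducible_quotient (Eop a as_) (Nd a as_ d w).
  by split=> //; apply: irreducible_quotient_Top => //; apply: Nd_subspace.
apply: (Nd_irreducible weyl a_w as_w gen Lf Mf Lp (ltn0Sn q0) Mq).
(* The universal property maps the module to series, where the coefficients of pure powers of z_(-p)
   supply the functionals [phi]. *)
have [f [f_lin f_w f_op]] := univ _ _ _ (one C)
  (series_weyl (lamE lam) (muE mu)) (series_whittaker _ _).
pose k0 := - (p0 : nat)%:Z; pose phi k v := f v (pure_power k0 k).
have f_z j v : f (zop a as_ j v) = var j (f v).
  rewrite /zop; case: ifP => j0.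
    by rewrite (f_op _ _).1 aM_var ?opprK //; lia.
  by rewrite (f_op _ _).2 asM_var //; lia.
apply: (charge_functional_not_image weyl a_w as_w gen Lf Mf Lp (phi := phi)).
- by move=> k b u v; rewrite /phi f_lin !fctE.
- by move=> k j v jk; rewrite /phi f_z var_pure_neq.
- by move=> v; rewrite /phi f_z var_pure.
- by move=> k v; rewrite /phi f_z var_pure.
- move=> k v; rewrite /phi -der_pure.
  have -> : der k0 (f v) = f (a p0 v) - lamE lam p0 *: f v.
    by rewrite (f_op _ _).1 aM_der addrC addKr.
  rewrite /Dop ifF; last by lia.
  by rewrite opprK abszN (linear_rules f_lin) (linear_rules f_lin)
             (linear_rules f_lin).
- by move=> k; rewrite /phi f_w one_pure.
Qed.

Theorem theorem7p4 (R : realType) (n m : nat) (hm : (0 < m)%N)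
  (lam : 'I_n.+1 -> R[i]) (mu : 'I_m -> R[i])
  (hlam : exists k, lam k != 0) (hmu : exists k, mu k != 0)
  (V : lmodType R[i]) (a as_ : int -> V -> V) (w : V)
  (hV : is_whittaker_module a as_ lam mu w) (d : R[i]) :
  irreducible_quotient (Eop a as_) (Nd a as_ d w) /\
  irreducible_quotient (Top a as_) (Nd a as_ d w).
Proof. exact: whittaker_irreducible hlam hmu V a as_ w hV d. Qed.
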